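(* Let $X_0,X_1,X_2,X_3$ be a real-valued (possibly time-inhomogeneous) Markov chain with transition kernels $p_1,p_2,p_3$ ($p_n$ from $X_{n-1}$ to $X_n$). Assume that each $p_n$ ($n=1,2,3$) is stochastically monotone and that, for each $n=1,2,3$ and each $y\in\mathbb{R}$, $p_n(x,(x+y,\infty))$ is nonincreasing in $x$. Assume that $p_1$ has an invariant distribution $\pi_1$ and that $X_0$ is $\pi_1$-distributed. Then for every Borel supermodular $h:\mathbb{R}^2\to\mathbb{R}$, $$\mathbb{E}\,h(X_0,X_2-X_3)\le \mathbb{E}\,h(X_1,X_2-X_3)$$ whenever the expectations exist and are finite. In particular, if $f:\mathbb{R}\to\mathbb{R}$ is nondecreasing and the appropriate expectations (those making all the covariances below well defined and finite) exist and are finite, then $$0\le \mathrm{Cov}(f(X_0),X_2)-\mathrm{Cov}(f(X_0),X_3)\le \mathrm{Cov}(f(X_1),X_2)-\mathrm{Cov}(f(X_1),X_3).$$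
   Context: A Markov transition kernel $p(x,A)$ ($x\in\mathbb{R}$, $A\subset\mathbb{R}$ Borel) is such that $p(\cdot,A)$ is a Borel function for every Borel $A$ and $p(x,\cdot)$ is a probability measure for every $x$. It is stochastically monotone if $p(x,(y,\infty))$ is nondecreasing in $x$ for each $y\in\mathbb{R}$. A Markov chain has transition kernels $p_1,p_2,\ldots$ if the conditional distribution of $X_n$ given $X_0,\ldots,X_{n-1}$ is $p_n(X_{n-1},\cdot)$. A probability measure $\pi$ is invariant for a kernel $p$ if $\int_{\mathbb{R}}p(x,A)\,\pi(\mathrm{d}x)=\pi(A)$ for every Borel $A$. A function $h:\mathbb{R}^2\to\mathbb{R}$ is supermodular if $h(x_1,y_2)+h(x_2,y_1)\le h(x_1,y_1)+h(x_2,y_2)$ whenever $x_1\le x_2$ and $y_1\le y_2$. *)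

(* Defs.v *)
From HB Require Import structures.
From mathcomp Require Import all_boot all_order all_algebra.
From mathcomp Require Import all_classical all_reals all_analysis.
From mathcomp Require Import measurable_realfun.

Set Implicit Arguments.
Unset Strict Implicit.
Unset Printing Implicit Defensive.

Import Order.TTheory GRing.Theory Num.Theory.

Local Open Scope classical_set_scope.
Local Open Scope ring_scope.

Definition stochastically_monotone (R : realType) (p : R.-pker R ~> R) : Prop :=
  forall y : R, nondecreasing_fun (fun x : R => p x `]y, +oo[%classic).

Definition tail_shift_nonincreasing (R : realType) (p : R.-pker R ~> R) : Prop :=
  forall y : R, nonincreasing_fun (fun x : R => p x `](x + y), +oo[%classic).

Definition invariant_distribution (R : realType) (p : R.-pker R ~> R)
    (pi : probability R R) : Prop :=
  forall A : set R, measurable A -> (\int[pi]_x p x A = pi A)%E.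

Definition supermodular (R : realType) (h : R * R -> R) : Prop :=
  forall x1 x2 y1 y2 : R, x1 <= x2 -> y1 <= y2 ->
    h (x1, y2) + h (x2, y1) <= h (x1, y1) + h (x2, y2).

(* G is the family of events of a sub-sigma-algebra; kappa w A is a version of
   P(Y in A | G)(w) for every Borel A. *)
Definition conditional_distribution d (T : measurableType d) (R : realType)
    (P : probability T R) (G : set (set T)) (Y : {RV P >-> R})
    (kappa : T -> {measure set R -> \bar R}) : Prop :=
  forall A : set R, measurable A ->
    (forall U : set (\bar R), measurable U ->
       G ((fun w => kappa w A) @^-1` U)) /\
    forall B : set T, G B ->
      (P (B `&` Y @^-1` A) = \int[P]_(w in B) kappa w A)%E.

(* p n is the kernel from X (n - 1) to X n; only X 0, ..., X N and
   p 1, ..., p N are constrained. *)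
Definition markov_chain d (T : measurableType d) (R : realType)
    (P : probability T R) (N : nat) (X : nat -> {RV P >-> R})
    (p : nat -> R.-pker R ~> R) : Prop :=
  forall n : nat, (n < N)%N ->
    conditional_distribution
      (g_sigma_preimage (fun i : 'I_n.+1 => X i : T -> R))
      (X n.+1) (fun w => p n.+1 (X n w)).

(* Main.v *)
Require Import Defs.
From HB Require Import structures.
From mathcomp Require Import all_boot all_order all_algebra.
From mathcomp Require Import all_classical all_reals all_analysis.
From mathcomp Require Import measurable_realfun.
From mathcomp Require Import lra.

(** The chain can be rebuilt from independent uniform variables through
quantile functions: given the past, X_n is distributed as Q_n (X_(n-1), U)
where Q_n (x, u) is the u-quantile of p_n (x, -).  Stochastic monotonicity says
that Q_n is nondecreasing in x, and the condition on the shifted tails says that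
x - Q_n (x, u) is nondecreasing in x.  Hence D = X_2 - X_3 is, conditionally on
(X_0, X_1), of the form psi (X_1, U) with psi nondecreasing in its first
argument and U independent of the pair ([monotone_response]).  Freezing U
reduces the comparison of E h (X_0, D) with E h (X_1, D) to the case in which D
is a deterministic nondecreasing function psi of X_1.

In that case the argument is the duality of one-dimensional optimal transport.
The supermodular function (x, z) |-> h (x, psi z) has a potential, that is, a
Borel function u with u y - u x <= h (y, psi y) - h (x, psi y) for all x and y
([potential_le]).  Since pi_1 is invariant, X_0 and X_1 have the same law, so
u (X_1) - u (X_0) should have mean zero, which gives the inequality.

Only the two expectations in the statement are assumed to be finite, and
u (X_1) - u (X_0) need not be integrable.  What survives without integrability
is that a variable W which dominates u (X_1) - u (X_0) has a negative part of
integral at most that of its positive part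
([integral_funrneg_le_funrpos_coboundary]).  This one-sided form consists of
integrals of nonnegative functions, so it can be integrated over U by Tonelli
without any further hypothesis ([monotone_response_integral_ge0]).

The upper bound on the covariances is the case h (x, y) = f x * y.  For the
lower bound one more step of the chain makes D a random nondecreasing function
of X_0; for a frozen nondecreasing g, the variable (f (X_0) - m) * g (X_0),
with m the mean of f (X_0), dominates c * (f (X_0) - m), which has mean zero,
as soon as c separates the values of g where f < m from those where f > m
([covariance_ge0_of_response]). *)

Set Implicit Arguments.
Unset Strict Implicit.
Unset Printing Implicit Defensive.

Import Order.TTheory GRing.Theory Num.Theory.

Local Open Scope classical_set_scope.
Local Open Scope ring_scope.

(** * A potential for a supermodular function *)

Section potential.
Context (R : realType) (h : R * R -> R) (psi : R -> R).
Hypotheses (h_super : supermodular h) (psi_nd : nondecreasing_fun psi).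

Definition climb_step (s t : R) : R := h (t, psi s) - h (s, psi s).

(** The values [v] reached at [b] are the sums of the steps along increasing
finite chains from [a] to [b].  The potential is built from the supremum of
these sums, as in Rockafellar's construction, but with increasing chains only,
which suffices on the line. *)
Inductive climb (a : R) : R -> R -> Prop :=
| climb_nil : climb a a 0
| climb_rcons s b v :
    climb a s v -> s <= b -> climb a b (v + climb_step s b).

Definition height (a b : R) : R := sup [set v | climb a b v].

Lemma climb_le a b v : climb a b v -> a <= b.
Proof. by elim=> [//|s b' v' _ /le_trans]; apply. Qed.

(** Supermodularity bounds each step by the one whose second argument is already
that of the endpoint [b], and these telescope. *)
Lemma climb_ub a b v :
  climb a b v -> v <= h (b, psi b) - h (a, psi b).
Proof.
elim=> [|s b' v' asv IH sb]; first by rewrite subrr.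
have := h_super (le_trans (climb_le asv) sb) (psi_nd sb).
by rewrite /climb_step; lra.
Qed.

Lemma climb_cat a b c v w : climb a b v -> climb b c w -> climb a c (v + w).
Proof.
move=> abv; elim=> [|s c' w' _ IH sc]; first by rewrite addr0.
by rewrite addrA; exact: climb_rcons.
Qed.

(** By supermodularity a chain can be made to pass through any given
intermediate point without lowering its sum; this makes [height] additive. *)
Lemma climb_split a b c v : climb a c v -> a <= b -> b <= c ->
  exists v1 v2, [/\ climb a b v1, climb b c v2 & v <= v1 + v2].
Proof.
move=> acv ab; elim: acv => [|s c' v' asv IH sc] bc.
  have -> : b = a by apply/le_anti/andP.
  by exists 0, 0; split; [exact: climb_nil|exact: climb_nil|rewrite addr0].
have [bs|/ltW sb] := leP b s.
  have [v1 [v2 [av1 bv2 v12]]] := IH bs.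
  exists v1, (v2 + climb_step s c'); split=> //; first exact: climb_rcons.
  by move: v12; lra.
exists (v' + climb_step s b), (0 + climb_step b c'); split.
- exact: climb_rcons.
- exact: climb_rcons (climb_nil _) bc.
- have := h_super bc (psi_nd sb); rewrite /climb_step; lra.
Qed.

Lemma climb1 a b : a <= b -> climb a b (climb_step a b).
Proof.
by move=> ab; rewrite -[climb_step _ _]add0r; exact: climb_rcons (climb_nil _) ab.
Qed.

Lemma has_sup_climb a b : a <= b -> has_sup [set v | climb a b v].
Proof.
move=> ab; split; first by exists (climb_step a b); exact: climb1.
by exists (h (b, psi b) - h (a, psi b)) => v; exact: climb_ub.
Qed.

Lemma climb_step_le_height a b : a <= b -> climb_step a b <= height a b.
Proof.
move=> ab; apply: ub_le_sup (climb1 ab).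
by have [] := has_sup_climb ab.
Qed.

Lemma height_ub a b : a <= b -> height a b <= h (b, psi b) - h (a, psi b).
Proof.
by move=> ab; apply: ge_sup; [have [] := has_sup_climb ab|move=> v; exact: climb_ub].
Qed.

Lemma heightD a b c : a <= b -> b <= c -> height a c = height a b + height b c.
Proof.
move=> ab bc; have ac := le_trans ab bc.
apply/eqP; rewrite eq_le; apply/andP; split.
  apply: ge_sup; first by have [] := has_sup_climb ac.
  move=> v acv; have [v1 [v2 [av1 bv2 /le_trans]]] := climb_split acv ab bc.
  apply; apply: lerD; apply: ub_le_sup => //.
    by have [] := has_sup_climb ab.
  by have [] := has_sup_climb bc.
rewrite -sup_sumE; [|exact: has_sup_climb|exact: has_sup_climb].
apply: ge_sup.
  exists (climb_step a b + climb_step b c).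
  exists (climb_step a b); first exact: climb1.
  by exists (climb_step b c) => //; exact: climb1.
move=> _ [v abv [w bcw <-]]; apply: ub_le_sup; last exact: climb_cat abv bcw.
by have [] := has_sup_climb ac.
Qed.

Definition potential (x : R) : R := if 0 <= x then height 0 x else - height x 0.

Lemma potentialB a b : a <= b -> potential b - potential a = height a b.
Proof.
move=> ab; rewrite /potential; case: (leP 0 a) => a0.
  by rewrite (le_trans a0 ab) (heightD a0 ab) addrAC subrr add0r.
case: (leP 0 b) => b0; first by rewrite (heightD (ltW a0) b0) opprK addrC.
by rewrite (heightD ab (ltW b0)) opprK addrC addrK.
Qed.

(** For [x <= y] this is the upper bound on [height]; for [y <= x] it is the
lower bound given by the one-step chain. *)
Lemma potential_le x y :
  potential y - potential x <= h (y, psi y) - h (x, psi y).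
Proof.
have [xy|/ltW yx] := leP x y; first by rewrite potentialB// height_ub.
by have := climb_step_le_height yx; rewrite -potentialB// /climb_step; lra.
Qed.

(** The difference between the potential and [x |-> h (x, psi 0)] is
nondecreasing on the nonnegative half-line and nonincreasing on the other one,
hence Borel, although the potential is a supremum of an uncountable family. *)
Lemma measurable_potential :
  measurable_fun [set: R * R] h -> measurable_fun [set: R] potential.
Proof.
move=> mh; pose g x := potential x - h (x, psi 0).
have g_nd x y : 0 <= x -> x <= y -> g x <= g y.
  move=> x0 xy; rewrite /g.
  have := climb_step_le_height xy; rewrite -potentialB// /climb_step.
  have := h_super xy (psi_nd x0); lra.
have g_ni x y : y <= 0 -> x <= y -> g y <= g x.
  move=> y0 xy; rewrite /g.
  have := potential_le x y; have := h_super xy (psi_nd y0); lra.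
have -> : potential = (fun x => g (Num.max x 0) + g (Num.min x 0) - g 0 + h (x, psi 0)).
  apply/funext => x; have [x0|x0] := leP x 0.
    by rewrite (_ : g 0 + g x - g 0 = g x) /g; lra.
  by rewrite (_ : g x + g 0 - g 0 = g x) /g; lra.
apply: measurable_funD; last by apply: measurableT_comp mh _; exact: measurable_pair2.
apply: measurable_funB => //; apply: measurable_funD.
- apply: nondecreasing_measurable => // x y xy.
  by apply: g_nd; [rewrite le_max lexx orbT|exact: le_max2].
- apply: nonincreasing_measurable => // x y xy.
  by apply: g_ni; [rewrite ge_min lexx orbT|exact: le_min2].
Qed.

End potential.

(** * Variables dominating a coboundary *)

Lemma clampB_le (R : realDomainType) (n x y : R) : 0 <= n ->
  Num.max (- n) (Num.min n y) - Num.max (- n) (Num.min n x) <= Num.max (y - x) 0.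
Proof.
move=> n0; case: (leP n y) => ny; case: (leP n x) => nx.
all: case: (leP (- n) y) => ny'; case: (leP (- n) x) => nx'.
all: case: (leP (- n) n) => nn; case: (leP (y - x) 0) => yx; lra.
Qed.

Section same_law.
Local Open Scope ereal_scope.
Context d (T : measurableType d) (R : realType) (P : probability T R).

Lemma ge0_integral_same_law (A B : T -> R) (g : R -> \bar R) :
  measurable_fun setT A -> measurable_fun setT B ->
  (forall S, measurable S -> P (A @^-1` S) = P (B @^-1` S)) ->
  measurable_fun setT g -> (forall x, 0 <= g x) ->
  \int[P]_w g (A w) = \int[P]_w g (B w).
Proof.
move=> mA mB AB mg g0.
have E (C : T -> R) : measurable_fun setT C ->
    \int[P]_w g (C w) = \int[pushforward P C]_y g y.
  by move=> mC; rewrite ge0_integral_pushforward.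
rewrite !E//; pose isA := isMeasurableFun.Build _ _ _ _ _ mA.
pose isB := isMeasurableFun.Build _ _ _ _ _ mB.
pose A' : {mfun T >-> R} := HB.pack A isA.
pose B' : {mfun T >-> R} := HB.pack B isB.
apply: (@eq_measure_integral _ _ _ _ (pushforward P B') (pushforward P A')) => S mS _.
exact: AB.
Qed.

(** If [u] is truncated at level [n], the bounded variables [v n (A w)] and [v
n (B w)] have the same mean, so subtracting their difference from the positive
part of [W] does not change the integral; the result is nonnegative because
truncation is monotone and 1-Lipschitz. Fatou's lemma then removes the
truncation, and the limit dominates the negative part of [W]. *)
Lemma integral_funrneg_le_funrpos_coboundary (A B : T -> R) (u : R -> R)
    (W : T -> R) :
  measurable_fun setT A -> measurable_fun setT B ->
  (forall S, measurable S -> P (A @^-1` S) = P (B @^-1` S)) ->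
  measurable_fun setT u -> measurable_fun setT W ->
  (forall w, u (B w) - u (A w) <= W w)%R ->
  \int[P]_w (W^\- w)%:E <= \int[P]_w (W^\+ w)%:E.
Proof.
move=> mA mB AB mu mW uW.
pose v (n : nat) x := Num.max (- n%:R)%R (Num.min n%:R (u x)).
have mv n : measurable_fun setT (v n).
  by apply: measurable_maxr => //; exact: measurable_minr.
have v_bnd n x : (- n%:R <= v n x <= n%:R)%R.
  have n0 : (0 <= n%:R :> R)%R by exact: ler0n.
  rewrite /v le_max lexx ge_max ge_min lexx /= andbT; lra.
have vW n w : (v n (B w) - v n (A w) <= W^\+ w)%R.
  apply: (@le_trans _ _ (Num.max (u (B w) - u (A w)) 0)%R).
    have n0 : (0 <= n%:R :> R)%R by exact: ler0n.
    exact: clampB_le.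
  by rewrite /funrpos; apply: le_max2.
pose f n w := (W^\+ w - (v n (B w) - v n (A w)))%:E.
have f0 n w : 0 <= f n w by rewrite lee_fin subr_ge0.
have mWp : measurable_fun setT (W^\+)%R by exact: measurable_funrpos.
have mf n : measurable_fun setT (f n).
  apply/measurable_EFinP; apply: measurable_funB => //.
  by apply: measurable_funB; exact: measurableT_comp.
have intf n : \int[P]_w f n w = \int[P]_w (W^\+ w)%:E.
  have mvn (C : T -> R) : measurable_fun setT C ->
      measurable_fun setT (fun w => (v n (C w) + n%:R)%:E).
    move=> mC; apply/measurable_EFinP; apply: measurable_funD => //.
    exact: measurableT_comp.
  have vn0 x : 0 <= (v n x + n%:R)%:E.
    by rewrite lee_fin; have /andP[+ _] := v_bnd n x; lra.
  have same : \int[P]_w (v n (A w) + n%:R)%:E = \int[P]_w (v n (B w) + n%:R)%:E.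
    apply: (ge0_integral_same_law (g := fun x => (v n x + n%:R)%:E)) => //.
    by apply/measurable_EFinP; apply: measurable_funD.
  have fin : \int[P]_w (v n (B w) + n%:R)%:E \is a fin_num.
    rewrite ge0_fin_numE ?integral_ge0//.
    apply: (@le_lt_trans _ _ (\int[P]_w (n%:R + n%:R)%:E)).
      apply: ge0_le_integral => //; first exact: mvn.
      by move=> w _; rewrite lee_fin lerD2r; have /andP[] := v_bnd n (B w).
    by rewrite integral_cst// [X in _ * X]probability_setT mule1 ltry.
  have : \int[P]_w f n w + \int[P]_w (v n (B w) + n%:R)%:E =
         \int[P]_w (W^\+ w)%:E + \int[P]_w (v n (A w) + n%:R)%:E.
    rewrite -ge0_integralD//; last exact: mvn.
    rewrite -ge0_integralD//; first last.
    - exact: mvn.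
    - exact/measurable_EFinP.
    - by move=> w _; rewrite lee_fin funrpos_ge0.
    by apply: eq_integral => w _; rewrite /f -!EFinD; congr EFin; lra.
  by rewrite same => E; rewrite -[LHS](addeK _ fin) E addeK.
have limf w : f ^~ w @ \oo --> (W^\+ w - (u (B w) - u (A w)))%:E.
  apply: cvg_near_cst; near=> n.
  have vn x : (`|u x| <= n%:R)%R -> v n x = u x.
    rewrite ler_norml => /andP[? ?].
    by rewrite /v (min_idPr _)// (max_idPr _).
  by rewrite /f !vn//; near: n; exact: nbhs_infty_ger.
have intWn : \int[P]_w (W^\- w)%:E <= \int[P]_w (W^\+ w - (u (B w) - u (A w)))%:E.
  apply: ge0_le_integral => //.
  - by move=> w _; rewrite lee_fin funrneg_ge0.
  - by apply/measurable_EFinP; exact: measurable_funrneg.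
  - apply/measurable_EFinP; apply: measurable_funB => //.
    by apply: measurable_funB; exact: measurableT_comp.
  - move=> w _; rewrite lee_fin.
    have E : (W^\+ w - W^\- w = W w)%R := congr1 (@^~ w) (funrposBneg W).
    by have := uW w; rewrite -E; lra.
apply: (le_trans intWn).
have := fatou P measurableT mf (fun n w _ => f0 n w).
rewrite (eq_integral (fun w => (W^\+ w - (u (B w) - u (A w)))%:E)); last first.
  by move=> w _; rewrite (cvg_limn_einf_sup (limf w)).1.
move=> le_liminf; apply: (le_trans le_liminf).
rewrite (_ : (fun n => \int[P]_w f n w) = cst (\int[P]_w (W^\+ w)%:E)); last first.
  by apply/funext => n; rewrite intf.
by rewrite (cvg_limn_einf_sup (cvg_cst _)).1.
Unshelve. all: by end_near.
Qed.

End same_law.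

(** * Quantiles *)

Section quantile.
Context (R : realType).

(** The default value outside ]0, 1[ is constant, so that monotonicity
properties of quantiles hold for every [u]. *)
Definition quantile (mu : set R -> \bar R) (u : R) : R :=
  if 0 < u < 1 then inf [set t | (u%:E <= mu `]-oo, t]%classic)%E] else 0.

Definition uniform01 : probability (measurableTypeR R) R :=
  [the probability _ _ of uniform_prob (@ltr01 R)].

Lemma uniform01E (A : set (measurableTypeR R)) : measurable A -> 
  uniform01 A = lebesgue_measure (A `&` `]0, 1[%classic).
Proof.
move=> mA.
have E (B : set (measurableTypeR R)) : measurable B -> B `<=` `]0, 1[%classic ->
    uniform01 B = lebesgue_measure B.
  move=> mB B01; rewrite /uniform01 /= /uniform_prob.
  rewrite (eq_integral (cst 1%E)) ?integral_cst ?mul1e// => x; rewrite inE => /B01 /=.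
  by rewrite in_itv /= /uniform_pdf => /andP[/ltW -> /ltW ->]; rewrite subr0 invr1.
have m01 : measurable (`]0, 1[%classic : set (measurableTypeR R)) by exact: measurable_itv.
have u01 : uniform01 `]0, 1[%classic = 1%E.
  by rewrite E// lebesgue_measure_itv/= lte_fin ltr01 sube0.
have uC01 : uniform01 (A `&` ~` `]0, 1[%classic) = 0%E.
  apply/eqP; rewrite eq_le measure_ge0 andbT.
  apply: (@le_trans _ _ (uniform01 (~` `]0, 1[%classic))).
    by apply: le_measure; rewrite ?inE//; [apply: measurableI => //|]; exact: measurableC.
  by rewrite probability_setC// u01 subee.
rewrite -E; [|exact: measurableI|by move=> x []].
rewrite -[A in LHS]setIT -(setUv `]0, 1[%classic) setIUr measureU//.
- by rewrite [X in (_ + X)%E]uC01 adde0.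
- exact: measurableI.
- by apply: measurableI => //; exact: measurableC.
- by rewrite setIACA setICr setI0.
Qed.

(** The Galois connection between the quantile and the distribution function;
it uses the limits of the latter at both infinities and its right continuity.
*)
Lemma quantile_le (mu : probability R R) (u t : R) : 0 < u < 1 ->
  (quantile mu u <= t) = (u%:E <= mu `]-oo, t]%classic)%E.
Proof.
move=> u01; rewrite /quantile u01; move: u01 => /andP[u0 u1].
set S := [set t | _].
pose I : {RV mu >-> R} := HB.pack (@idfun R)
  (isMeasurableFun.Build _ _ _ _ _ (@measurable_id _ R setT)).
have cdfE r : cdf I r = mu `]-oo, r]%classic by [].
have F_nd : {homo (fun r => mu `]-oo, r]%classic) : r s / r <= s >-> (r <= s)%E}.
  by move=> r s rs; rewrite -!cdfE; exact: cdf_nondecreasing.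
have S_lb : has_lbound S.
  have /fine_cvg/cvgr_lt/(_ _ u0)[M [_ FM]] := @cvg_cdfNy0 _ _ _ mu I.
  exists (M - 1) => s; rewrite /S /= => us.
  rewrite leNgt; apply/negP => sM.
  have /FM : s < M by rewrite (lt_trans sM)// ltrBlDr ltrDl.
  by rewrite /= cdfE -lte_fin fineK ?fin_num_measure// ltNge us.
have S_ne : S !=set0.
  have /fine_cvg/cvgr_gt/(_ _ u1)[M [_ FM]] := @cvg_cdfy1 _ _ _ mu I.
  exists (M + 1); rewrite /S /= -cdfE -[leRHS]fineK ?fin_num_measure//.
  by rewrite lee_fin ltW// FM// ltrDl.
apply/idP/idP => [St|]; last by move=> ut; apply: ge_inf.
have := @cdf_right_continuous _ _ _ mu I t.
apply: cvge_ge; near=> s; have ts : t < s by near: s; exact: nbhs_right_gt.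
have [r ur rs] := inf_lt S_ne (le_lt_trans St ts).
exact: le_trans ur (F_nd _ _ (ltW rs)).
Unshelve. all: by end_near. Qed.

End quantile.

Section kernel_quantile.
Context d (X : measurableType d) (R : realType) (p : R.-pker X ~> R).

(** The type of a kernel only makes [p x] a measure; this name for it carries
the structure of a probability measure, which the distribution function theory
needs. *)
Definition pker_law (x : X) : set R -> \bar R := p x.

HB.instance Definition _ x := Measure.copy (pker_law x) (p x).
HB.instance Definition _ x :=
  Measure_isProbability.Build _ _ _ (pker_law x) (prob_kernel x).

Let prob x : probability R R := pker_law x.

Lemma pker_quantile_le x (u t : R) : 0 < u < 1 ->
  (quantile (p x) u <= t) = (u%:E <= p x `]-oo, t]%classic)%E.
Proof. exact: (@quantile_le R (prob x)). Qed.

(** Joint measurability follows from [pker_quantile_le], since each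
distribution function value [p x `]-oo, t]] is measurable in [x]. *)
Lemma measurable_pker_quantile :
  measurable_fun [set: X * measurableTypeR R]
    (fun xu => quantile (p xu.1) xu.2).
Proof.
pose K t x := fine (p x `]-oo, t]%classic).
have mK t : measurable_fun [set: X] (K t).
  apply: measurableT_comp; first exact: fine_measurable.
  exact: measurable_kernel.
apply: (measurability _ (RGenOInfty.measurableE R)).
move=> _ [_ [t ->] <-]; rewrite setTI.
pose b xu := if (0 < xu.2 < 1) then K t xu.1 < xu.2 else t < 0.
have mb : measurable_fun [set: X * measurableTypeR R] b.
  apply: measurable_fun_ifT => /=.
  - by apply: measurable_and; apply: measurable_fun_ltr.
  - apply: measurable_fun_ltr => //.
    exact: measurableT_comp (mK t) _.
  - exact: measurable_cst.
have -> : (fun xu : X * measurableTypeR R => quantile (p xu.1) xu.2) @^-1`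
    `]t, +oo[%classic = b @^-1` [set true].
  have E x u : (t < quantile (p x) u) = b (x, u).
    rewrite /b /=; case: ifPn => u01; last by rewrite /quantile (negbTE u01).
    rewrite ltNge pker_quantile_le// -ltNge -[ltLHS]fineK ?lte_fin//.
    by rewrite (@fin_num_measure _ _ _ (prob x)).
  by apply/seteqP; split=> -[x u] /=; rewrite in_itv /= andbT E.
by rewrite -[X in measurable X]setTI; exact: mb.
Qed.

Lemma measurable_quantile x :
  measurable_fun [set: measurableTypeR R] (quantile (p x)).
Proof. exact: (measurableT_comp measurable_pker_quantile (measurable_pair1 x)). Qed.

(** Inverse transform sampling: the quantile of a uniform variable has law [p
x]. Both laws agree on the rays, by [pker_quantile_le]. *)
Lemma uniform01_quantile x (S : set R) : measurable S ->
  uniform01 R (quantile (p x) @^-1` S) = p x S.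
Proof.
move=> mS; pose Q : {mfun measurableTypeR R >-> R} :=
  HB.pack (quantile (p x)) (isMeasurableFun.Build _ _ _ _ _ (measurable_quantile x)).
have mQ t : measurable (quantile (p x) @^-1` `]-oo, t]%classic : set (measurableTypeR R)).
  by rewrite -[X in measurable X]setTI; exact: measurable_quantile.
have ray t : uniform01 R (quantile (p x) @^-1` `]-oo, t]%classic) = p x `]-oo, t]%classic.
  rewrite uniform01E; last exact: mQ.
  set F := p x _; pose a := fine F.
  have aE : F = a%:E by rewrite /a fineK// (@fin_num_measure _ _ _ (prob x)).
  have a0 : 0 <= a by rewrite fine_ge0 // measure_ge0.
  have a1 : a <= 1.
    by rewrite -lee_fin -aE; exact: (@probability_le1 _ _ _ (prob x)).
  have -> : quantile (p x) @^-1` `]-oo, t]%classic `&` `]0, 1[%classic =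
      if a < 1 then `]0, a]%classic else `]0, 1[%classic.
    apply/seteqP; split=> u /=; rewrite !in_itv /=.
      move=> [+ u01]; rewrite pker_quantile_le// -/F aE lee_fin => ua.
      by case: ifP => _ /=; rewrite in_itv /= ?ua ?andbT//; case/andP: u01.
    case: ltP => a1' /=; rewrite in_itv /= => /andP[u0 ua].
      have u01 : 0 < u < 1 by rewrite u0 (le_lt_trans ua).
      by split=> //; rewrite pker_quantile_le// -/F aE lee_fin.
    have u01 : 0 < u < 1 by rewrite u0.
    by split=> //; rewrite pker_quantile_le// -/F aE lee_fin ltW// (lt_le_trans ua).
  rewrite aE; case: ltP => a1'; rewrite lebesgue_measure_itv /= lte_fin.
    by case: ltP => a0'; rewrite ?sube0//; congr EFin; apply/le_anti; rewrite a0 a0'.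
  by rewrite ltr01 sube0; congr EFin; apply/le_anti; rewrite a1 a1'.
apply: (measure_unique (@RGenOInfty.G R) (fun n => `]- n%:R, +oo[%classic)
   _ _ _ _ (distribution (uniform01 R) Q) (prob x)) => //.
- exact: (RGenOInfty.measurableE R).
- move=> _ _ [s ->] [t ->]; exists (Num.max s t).
  by apply/seteqP; split=> u /=; rewrite !in_itv /= !andbT gt_max => /andP.
- by move=> n; exists (- n%:R).
- rewrite -subTset => u _; exists (Num.bound `|u|) => //=.
  rewrite in_itv /= andbT ltrNl.
  by rewrite (le_lt_trans _ (archi_boundP _))// -normrN ler_norm.
- move=> _ [t ->]; rewrite -setCitvl.
  have mt : measurable (`]-oo, t]%classic : set R) by exact: measurable_itv.
  apply: etrans (probability_setC (distribution (uniform01 R) Q) mt) _.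
  apply: etrans (esym (probability_setC (prob x) mt)).
  by congr (_ - _)%E; exact: ray.
- by move=> k; rewrite (le_lt_trans (probability_le1 _ _)) ?ltry.
Qed.

End kernel_quantile.

Section monotone_quantile.
Context (R : realType) (p : R.-pker R ~> R).

Lemma pker_le_tail (x y s t : R) :
  (p x `]s, +oo[%classic <= p y `]t, +oo[%classic)%E =
  (p y `]-oo, t]%classic <= p x `]-oo, s]%classic)%E.
Proof.
have E z r : p z `]r, +oo[%classic = (1 - p z `]-oo, r]%classic)%E.
  by rewrite -setCitvl; exact: (@probability_setC _ _ _ (pker_law p z : probability R R)).
by rewrite !E leeD2lE // leeN2.
Qed.

Lemma nondecreasing_quantile (u : R) : stochastically_monotone p ->
  nondecreasing_fun (fun x => quantile (p x) u).
Proof.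
move=> mono x y xy; case: (boolP (0 < u < 1)) => u01; last first.
  by rewrite /quantile (negbTE u01).
rewrite pker_quantile_le//.
have : (u%:E <= p y `]-oo, (quantile (p y) u)]%classic)%E by rewrite -pker_quantile_le.
move=> /le_trans; apply; rewrite -pker_le_tail; exact: mono.
Qed.

Lemma nondecreasing_sub_quantile (u : R) : tail_shift_nonincreasing p ->
  nondecreasing_fun (fun x => x - quantile (p x) u).
Proof.
move=> shift x y xy; case: (boolP (0 < u < 1)) => u01; last first.
  by rewrite /quantile (negbTE u01) !subr0.
suff : quantile (p y) u <= y + (quantile (p x) u - x) by lra.
rewrite pker_quantile_le//.
have : (u%:E <= p x `]-oo, (x + (quantile (p x) u - x))%R]%classic)%E.
  by rewrite -pker_quantile_le// addrC subrK.
by move=> /le_trans; apply; rewrite -pker_le_tail; exact: shift.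
Qed.

End monotone_quantile.

(** * One step of a Markov chain driven by a uniform variable *)

Section markov_step.
Local Open Scope ereal_scope.
Context d (T : measurableType d) (R : realType) (P : probability T R).

Lemma g_sigma_preimage_coord n (f : 'I_n -> T -> R) (i : 'I_n) (A : set R) :
  measurable A -> g_sigma_preimage f (f i @^-1` A).
Proof.
move=> mA; apply: sub_sigma_algebra; rewrite (bigD1 i)//=; left.
by exists A => //; rewrite setTI.
Qed.

Lemma g_sigma_preimage_pair n (f : 'I_n -> T -> R) d1 d2 (E1 : measurableType d1)
    (E2 : measurableType d2) (Z1 : T -> E1) (Z2 : T -> E2) :
  (forall A, measurable A -> g_sigma_preimage f (Z1 @^-1` A)) ->
  (forall A, measurable A -> g_sigma_preimage f (Z2 @^-1` A)) ->
  forall A, measurable A -> g_sigma_preimage f ((fun w => (Z1 w, Z2 w)) @^-1` A).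
Proof.
rewrite /g_sigma_preimage; set C := \big[_/_]_(_ < _) _ => hZ1 hZ2 A mA.
pose TC := g_sigma_algebraType C.
have m1 : measurable_fun [set: TC] (Z1 : TC -> E1).
  by move=> _ B mB; rewrite setTI; exact: hZ1.
have m2 : measurable_fun [set: TC] (Z2 : TC -> E2).
  by move=> _ B mB; rewrite setTI; exact: hZ2.
rewrite -[X in <<s C>> X]setTI.
by apply: (@measurable_fun_pair _ _ _ TC _ _ _ _ m1 m2).
Qed.

(** Given the past, [Y] may be replaced by a quantile of an independent
uniform variable. Two laws on [E * R] are compared on rectangles, where the
equality is the definition of the conditional distribution. *)
Lemma integral_markov_step d' (E : measurableType d') (G : set (set T))
    (Y : {RV P >-> R}) (V : T -> R) (p : R.-pker R ~> R) (Z : T -> E)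
    (F : E * R -> \bar R) :
  measurable_fun setT V -> measurable_fun setT Z ->
  (forall A, measurable A -> G (Z @^-1` A)) ->
  conditional_distribution G Y (fun w => p (V w)) ->
  measurable_fun setT F -> (forall z, 0 <= F z) ->
  \int[P]_w F (Z w, Y w) =
  \int[P]_w \int[uniform01 R]_u F (Z w, quantile (p (V w)) u).
Proof.
move=> mV mZ GZ YV mF F0.
pose phi w := (Z w, Y w).
pose psi (wu : T * measurableTypeR R) := (Z wu.1, quantile (p (V wu.1)) wu.2).
have mphi : measurable_fun setT phi by apply: measurable_fun_pair.
have mpsi : measurable_fun setT psi.
  apply: measurable_fun_pair; first exact: measurableT_comp.
  have -> : (fun wu : T * measurableTypeR R => quantile (p (V wu.1)) wu.2) =
      (fun xu : R * measurableTypeR R => quantile (p xu.1) xu.2) \o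
      (fun wu : T * measurableTypeR R => (V wu.1, wu.2)) by [].
  apply: measurableT_comp; first exact: measurable_pker_quantile.
  by apply: measurable_fun_pair => //; exact: measurableT_comp.
pose Phi : {mfun T >-> (E * R)%type} := HB.pack phi (isMeasurableFun.Build _ _ _ _ _ mphi).
pose Psi : {mfun (T * measurableTypeR R)%type >-> (E * R)%type} :=
  HB.pack psi (isMeasurableFun.Build _ _ _ _ _ mpsi).
pose m1 := distribution P Phi.
pose m2 := distribution (P \x uniform01 R) Psi.
have m12 S : measurable S -> m1 S = m2 S.
  move=> mS.
  apply: (measure_unique [set A `*` B | A in measurable & B in measurable]
     (fun=> setT) _ _ _ _ m1 m2) => //.
  - exact: measurable_prod_measurableType.
  - move=> _ _ [A mA [B mB <-]] [A' mA' [B' mB' <-]].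
    by rewrite -setXI; exists (A `&` A'); [exact: measurableI|
      exists (B `&` B') => //; exact: measurableI].
  - by move=> _; exists setT => //; exists setT => //; rewrite setXTT.
  - by rewrite bigcup_const.
  - move=> _ [A mA [B mB <-]].
    have mZA : measurable (Z @^-1` A) by rewrite -[X in measurable X]setTI; exact: mZ.
    apply: etrans ((YV B mB).2 _ (GZ A mA)) _.
    rewrite /m2 /distribution /pushforward /= /product_measure1.
    rewrite integral_mkcond; apply: eq_integral => w _.
    rewrite /= patchE; case: ifPn => ZA.
      have wA : A (Z w) by rewrite inE in ZA.
      rewrite -uniform01_quantile//; congr (uniform01 R _).
      apply/seteqP; split => u /=.
        by move=> ?; rewrite /xsection /= inE.
      by rewrite /xsection /= inE => -[].
    rewrite [X in uniform01 R X](_ : _ = set0) ?measure0//.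
    apply/seteqP; split=> // u; rewrite /xsection /= inE => -[/= Aw _].
    by move: ZA; rewrite notin_setE.
  - by move=> _; rewrite (le_lt_trans (probability_le1 _ _)) ?ltry.
transitivity (\int[m1]_z F z); first by rewrite ge0_integral_pushforward.
rewrite (eq_measure_integral m2); last by move=> S mS _; exact: m12.
rewrite ge0_integral_pushforward// preimage_setT.
rewrite (fubini_tonelli1 (F \o psi))//; first exact: measurableT_comp.
by move=> z; exact: F0.
Qed.

End markov_step.

(** * Random nondecreasing functions *)

Section monotone_response.
Local Open Scope ereal_scope.
Context d (T : measurableType d) (R : realType) (P : probability T R).

(** In law, and jointly with [Z], the variable [Y] is [psi (B, o)] with [o]
independent of [(Z, B)] and [psi] nondecreasing in its first argument. *)
Definition monotone_response d' (E : measurableType d') (Z : T -> E)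
    (B Y : T -> R) : Prop :=
  exists dOm (Om : measurableType dOm) (nu : probability Om R) (psi : R * Om -> R),
    [/\ measurable_fun setT psi,
        forall o, nondecreasing_fun (fun x => psi (x, o)) &
        forall F : E * R -> \bar R, measurable_fun setT F -> (forall z, 0 <= F z) ->
          \int[P]_w F (Z w, Y w) = \int[P]_w \int[nu]_o F (Z w, psi (B w, o))].

Lemma monotone_response_sub d' (E : measurableType d') (G : set (set T))
    (V Y : {RV P >-> R}) (p : R.-pker R ~> R) (Z : T -> E) :
  measurable_fun setT Z ->
  (forall A, measurable A -> G ((fun w => (Z w, V w)) @^-1` A)) ->
  conditional_distribution G Y (fun w => p (V w)) ->
  tail_shift_nonincreasing p ->
  monotone_response (fun w => (Z w, V w)) V (fun w => V w - Y w)%R.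
Proof.
move=> mZ GZ VY shift.
exists _, (measurableTypeR R), (uniform01 R),
  (fun xu => xu.1 - quantile (p xu.1) xu.2)%R; split.
- by apply: measurable_funB => //; exact: measurable_pker_quantile.
- by move=> u; exact: nondecreasing_sub_quantile.
move=> F mF F0.
have mZV : measurable_fun setT (fun w => (Z w, V w)) by exact: measurable_fun_pair.
rewrite (integral_markov_step (V := V) (p := p) (G := G) (Y := Y)
   (Z := fun w => (Z w, V w)) (F := fun zy => F (zy.1, zy.1.2 - zy.2)%R))//.
apply: measurableT_comp => //; apply: measurable_fun_pair => //.
by apply: measurable_funB => //; exact: measurableT_comp.
Qed.

(** Prepending a stochastically monotone transition from [B] to [V] composes
the nondecreasing maps; the new randomness is the product of the uniform
variable of the transition and the randomness of the old response. *)
Lemma monotone_response_step d' (E : measurableType d') (G : set (set T))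
    (V : {RV P >-> R}) (B Y : T -> R) (p : R.-pker R ~> R) (Z : T -> E) :
  measurable_fun setT B -> measurable_fun setT Z ->
  (forall A, measurable A -> G (Z @^-1` A)) ->
  conditional_distribution G V (fun w => p (B w)) ->
  stochastically_monotone p ->
  monotone_response (fun w => (Z w, V w)) V Y ->
  monotone_response Z B Y.
Proof.
move=> mB mZ GZ BV mono [dOm [Om [nu [psi [mpsi psi_nd YE]]]]].
have mQ := measurable_pker_quantile p.
exists _, (measurableTypeR R * Om)%type, (uniform01 R \x nu),
  (fun xuo => psi (quantile (p xuo.1) xuo.2.1, xuo.2.2)); split.
- apply: measurableT_comp => //; apply: measurable_fun_pair.
    apply: (measurableT_comp mQ (g := fun xuo => (xuo.1, xuo.2.1))).
    by apply: measurable_fun_pair => //; exact: measurableT_comp.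
  exact: measurableT_comp.
- by move=> [u o] x y xy /=; apply: psi_nd; exact: nondecreasing_quantile.
move=> F mF F0.
pose H zv := \int[nu]_o F (zv.1, psi (zv.2, o)).
have mH : measurable_fun setT H.
  apply: (measurable_fun_fubini_tonelli_F 
    (fun zvo : (E * R) * Om => F (zvo.1.1, psi (zvo.1.2, zvo.2)))) => //.
  apply: measurableT_comp => //; apply: measurable_fun_pair; first exact: measurableT_comp.
  apply: measurableT_comp => //; apply: measurable_fun_pair => //.
  exact: measurableT_comp.
rewrite (YE (fun zvy => F (zvy.1.1, zvy.2)))//; last first.
  apply: measurableT_comp => //; apply: measurable_fun_pair => //.
  exact: measurableT_comp.
transitivity (\int[P]_w H (Z w, V w)); first by [].
rewrite (integral_markov_step (G := G) (V := B) (p := p))//; last first.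
  by move=> z; exact: integral_ge0.
apply: eq_integral => w _.
rewrite (fubini_tonelli1 (fun uo : measurableTypeR R * Om =>
  F (Z w, psi (quantile (p (B w)) uo.1, uo.2))))//.
apply: measurableT_comp => //; apply: measurable_fun_pair => //.
apply: measurableT_comp => //; apply: measurable_fun_pair => //.
apply: measurableT_comp => //; exact: measurable_quantile.
Qed.

(** It suffices to prove the inequality with the response frozen to a
deterministic nondecreasing function [g], in the form comparing the negative
and positive parts, since those can be integrated over the randomness without
integrability conditions. Integrability is used once, at the end, to subtract.
*)
Lemma monotone_response_integral_ge0 d' (E : measurableType d') (Z : T -> E)
    (B Y : T -> R) (k : E * R -> R) :
  measurable_fun setT Z -> measurable_fun setT B ->
  monotone_response Z B Y -> measurable_fun setT k ->
  (forall g : R -> R, nondecreasing_fun g -> let W w := k (Z w, g (B w)) in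
    \int[P]_w (W^\- w)%:E <= \int[P]_w (W^\+ w)%:E) ->
  P.-integrable setT (fun w => (k (Z w, Y w))%:E) ->
  0 <= \int[P]_w (k (Z w, Y w))%:E.
Proof.
move=> mZ mB [dOm [Om [nu [psi [mpsi psi_nd YE]]]]] mk kg ik.
have swap (F : E * R -> \bar R) : measurable_fun setT F -> (forall z, 0 <= F z) ->
    \int[P]_w F (Z w, Y w) = \int[nu]_o \int[P]_w F (Z w, psi (B w, o)).
  move=> mF F0; rewrite YE//.
  rewrite (fubini_tonelli (fun wo => F (Z wo.1, psi (B wo.1, wo.2))))//.
  apply: measurableT_comp => //; apply: measurable_fun_pair.
    exact: measurableT_comp.
  apply: measurableT_comp => //; apply: measurable_fun_pair => //.
  exact: measurableT_comp.
have mW : measurable_fun setT (fun ow : Om * T => k (Z ow.2, psi (B ow.2, ow.1))).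
  apply: measurableT_comp => //; apply: measurable_fun_pair.
    exact: measurableT_comp.
  apply: measurableT_comp => //; apply: measurable_fun_pair => //.
  exact: measurableT_comp.
have le_pn : \int[P]_w (k^\- (Z w, Y w))%:E <= \int[P]_w (k^\+ (Z w, Y w))%:E.
  rewrite (swap (fun z => (k^\- z)%:E)); first last.
  - by move=> z; rewrite lee_fin funrneg_ge0.
  - by apply/measurable_EFinP; exact: measurable_funrneg.
  rewrite (swap (fun z => (k^\+ z)%:E)); first last.
  - by move=> z; rewrite lee_fin funrpos_ge0.
  - by apply/measurable_EFinP; exact: measurable_funrpos.
  apply: ge0_le_integral => //.
  - by move=> o _; apply: integral_ge0 => w _; rewrite lee_fin funrneg_ge0.
  - apply: (measurable_fun_fubini_tonelli_F 
      (fun ow : Om * T => (k^\- (Z ow.2, psi (B ow.2, ow.1)))%:E)).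
      by apply/measurable_EFinP; exact: (measurable_funrneg mW).
    by move=> ow; rewrite lee_fin funrneg_ge0.
  - apply: (measurable_fun_fubini_tonelli_F 
      (fun ow : Om * T => (k^\+ (Z ow.2, psi (B ow.2, ow.1)))%:E)).
      by apply/measurable_EFinP; exact: (measurable_funrpos mW).
    by move=> ow; rewrite lee_fin funrpos_ge0.
  - by move=> o _; exact: kg (psi_nd o).
rewrite integralE.
have En : \int[P]_w (fun w => (k (Z w, Y w))%:E)^\- w = \int[P]_w (k^\- (Z w, Y w))%:E.
  by rewrite (funerneg (fun w => k (Z w, Y w))).
have Ep : \int[P]_w (fun w => (k (Z w, Y w))%:E)^\+ w = \int[P]_w (k^\+ (Z w, Y w))%:E.
  by rewrite (funerpos (fun w => k (Z w, Y w))).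
have fin_n : \int[P]_w (k^\- (Z w, Y w))%:E \is a fin_num.
  by rewrite -En; exact: integrable_neg_fin_num.
by rewrite Ep En sube_ge0 ?fin_n ?orbT.
Qed.

(** The analogue of [integral_funrneg_le_funrpos_coboundary] for a dominated
variable that is integrable: move the parts of [g] to the other side and
cancel them. *)
Lemma integral_funrneg_le_funrpos_centered (W g : T -> R) :
  measurable_fun setT W -> P.-integrable setT (EFin \o g) ->
  \int[P]_w (g w)%:E = 0 -> (forall w, g w <= W w)%R ->
  \int[P]_w (W^\- w)%:E <= \int[P]_w (W^\+ w)%:E.
Proof.
move=> mW ig g0 gW.
have mg : measurable_fun setT g by apply/measurable_EFinP; case/integrableP: ig.
have gn_fin : \int[P]_w (g^\- w)%:E \is a fin_num.
  by have := integrable_neg_fin_num measurableT ig; rewrite funerneg.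
have gpn : \int[P]_w (g^\+ w)%:E = \int[P]_w (g^\- w)%:E.
  have := integralE P setT (EFin \o g); rewrite [LHS]g0 funerneg funerpos => g0E.
  by rewrite -[LHS](subeK _ gn_fin) -g0E add0e.
have mp (f : T -> R) : measurable_fun setT f -> measurable_fun setT (EFin \o (f^\+)%R).
  by move=> mf; apply/measurable_EFinP; exact: measurable_funrpos.
have mn (f : T -> R) : measurable_fun setT f -> measurable_fun setT (EFin \o (f^\-)%R).
  by move=> mf; apply/measurable_EFinP; exact: measurable_funrneg.
have : \int[P]_w (W^\- w)%:E + \int[P]_w (g^\+ w)%:E <=
       \int[P]_w (W^\+ w)%:E + \int[P]_w (g^\- w)%:E.
  rewrite -!ge0_integralD//; try exact: mp; try exact: mn;
    try (by move=> w _; rewrite lee_fin ?funrneg_ge0 ?funrpos_ge0).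
  apply: ge0_le_integral => //.
  - by move=> w _; rewrite adde_ge0// lee_fin ?funrneg_ge0 ?funrpos_ge0.
  - by apply: emeasurable_funD; [exact: mn|exact: mp].
  - by apply: emeasurable_funD; [exact: mp|exact: mn].
  - move=> w _; rewrite -!EFinD lee_fin; have := gW w.
    rewrite /funrneg /funrpos /Order.max.
    by do ![case: ifPn => [?|]]; rewrite -?leNgt; lra.
by rewrite gpn leeD2rE.
Qed.

End monotone_response.

(** * Centred nondecreasing functions *)

Section centred.
Context (R : realType).

(** Where [f < m] the values of [g] lie below those taken where [m < f]; any
[c] in between makes [(f x - m) * (g x - c)] nonnegative. The points [a] and
[b] ensure that such a real [c] exists. *)
Lemma nondecreasing_sign_change (f g : R -> R) (m a b : R) :
  nondecreasing_fun f -> nondecreasing_fun g -> f a <= m -> m <= f b ->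
  exists c, forall x, c * (f x - m) <= (f x - m) * g x.
Proof.
move=> f_nd g_nd fa fb.
suff [c cP] : exists c, forall x, (f x < m -> g x <= c) /\ (m < f x -> c <= g x).
  exists c => x; rewrite [leRHS]mulrC -subr_ge0 -mulrBl.
  have [lo hi] := cP x; case: (ltgtP (f x) m) => [fm|mf|->].
  - by rewrite mulr_le0// subr_le0// ?lo// ltW.
  - by rewrite mulr_ge0// subr_ge0// ?hi// ltW.
  - by rewrite subrr mulr0.
have f_lt x y : f x < f y -> x <= y.
  by move=> fxy; rewrite leNgt; apply/negP => /ltW/f_nd; rewrite leNgt fxy.
(* If the level m is attained at b, then g b separates; otherwise the supremum
   below is bounded by g b. *)
move: fb; rewrite le_eqVlt => /predU1P[mE|mb].
  by exists (g b) => x; rewrite mE; split=> /f_lt/g_nd.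
exists (sup [set g x | x in [set x | f x <= m]]) => x; split=> fx.
  apply: ub_le_sup; last by exists x => //=; exact: ltW.
  by exists (g b) => _ [y /= fy <-]; apply: g_nd; apply: f_lt; exact: le_lt_trans mb.
apply: ge_sup; first by exists (g a); exists a.
by move=> _ [y /= fy <-]; apply: g_nd; apply: f_lt; exact: le_lt_trans fx.
Qed.

Lemma integral_eq0_ex_le0 d (T : measurableType d) (P : probability T R) (g : T -> R) :
  P.-integrable setT (EFin \o g) -> (\int[P]_w (g w)%:E = 0)%E ->
  exists w, g w <= 0.
Proof.
move=> ig g0; apply: contrapT => /forallNP g_gt0.
have gpos w : 0 < g w by rewrite ltNge; exact/negP.
have mg : measurable_fun setT (EFin \o g) by case/integrableP: ig.
have : (\int[P]_w `|(EFin \o g) w| = 0)%E.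
  by rewrite -[RHS]g0; apply: eq_integral => w _ /=; rewrite ger0_norm// ltW.
move=> /(ae_eq_integral_abs _ measurableT mg)[N [mN PN0 subN]].
have NT : N = setT.
  rewrite -subTset => w _; apply: subN => /= /(_ Logic.I) [].
  by move/eqP; rewrite gt_eqF.
have : (0 = 1 :> \bar R)%E by rewrite -PN0 NT; exact: probability_setT.
by move=> /eqP; rewrite eqe eq_sym oner_eq0.
Qed.

End centred.

(** * The chain as a random monotone function of its past *)

Section chain.
Context (R : realType) (d : measure_display) (T : measurableType d)
  (P : probability T R) (X : nat -> {RV P >-> R}) (p : nat -> R.-pker R ~> R).
Hypotheses (hX : markov_chain 3 X p)
  (hmono : forall n : nat, (1 <= n <= 3)%N -> stochastically_monotone (p n))
  (hshift : forall n : nat, (1 <= n <= 3)%N -> tail_shift_nonincreasing (p n)).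

Let past n := g_sigma_preimage (fun i : 'I_n.+1 => X i : T -> R).

Let past_coord n i (A : set R) : (i <= n)%N -> measurable A -> past n (X i @^-1` A).
Proof.
move=> i_n mA.
exact: (@g_sigma_preimage_coord _ _ _ _ _ (Ordinal (i_n : (i < n.+1)%N))).
Qed.

Lemma monotone_response_past1 :
  monotone_response P (fun w => (X 0%N w, X 1%N w)) (X 1%N)
    (fun w => X 2%N w - X 3%N w).
Proof.
apply: (@monotone_response_step _ _ _ _ _ _ (past 1) (X 2%N) _ _ (p 2%N)) => //.
- exact: measurable_fun_pair.
- by apply: g_sigma_preimage_pair => A mA; exact: past_coord.
- exact: hX.
- exact: hmono.
apply: (@monotone_response_sub _ _ _ _ _ _ (past 2) (X 2%N) (X 3%N) (p 3%N)).
- exact: measurable_fun_pair.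
- apply: g_sigma_preimage_pair; last by move=> A mA; exact: past_coord.
  by apply: g_sigma_preimage_pair => A mA; exact: past_coord.
- exact: hX.
- exact: hshift.
Qed.

Lemma monotone_response_past0 :
  monotone_response P (X 0%N) (X 0%N) (fun w => X 2%N w - X 3%N w).
Proof.
apply: (@monotone_response_step _ _ _ _ _ _ (past 0) (X 1%N) _ _ (p 1%N)) => //.
- by move=> A mA; exact: past_coord.
- exact: hX.
- exact: hmono.
- exact: monotone_response_past1.
Qed.

Lemma invariant_same_law (pi1 : probability R R) :
  invariant_distribution (p 1%N) pi1 ->
  (forall A : set R, measurable A -> distribution P (X 0%N) A = pi1 A) ->
  forall A, measurable A -> P (X 0%N @^-1` A) = P (X 1%N @^-1` A).
Proof.
move=> hinv h0 A mA; apply: etrans (h0 A mA) _; rewrite -hinv//.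
have [_ /(_ setT)] := @hX 0%N isT A mA; rewrite setTI => ->; last first.
  by rewrite -(preimage_setT (X 0%N)); exact: past_coord.
rewrite (eq_measure_integral (distribution P (X 0%N))); last first.
  by move=> S mS _; exact/esym/h0.
by rewrite ge0_integral_distribution//; exact: measurable_kernel.
Qed.

End chain.

(** * Comparison of expectations and covariances *)

Section comparison.
Local Open Scope ereal_scope.
Context d (T : measurableType d) (R : realType) (P : probability T R).

(** For a frozen response [g], the increment [h (B, g B) - h (A, g B)]
dominates the coboundary of the potential of [h] along [g]. *)
Lemma supermodular_le_of_response (A B D : T -> R) (h : R * R -> R) :
  measurable_fun setT A -> measurable_fun setT B ->
  (forall S, measurable S -> P (A @^-1` S) = P (B @^-1` S)) ->
  monotone_response P (fun w => (A w, B w)) B D ->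
  measurable_fun setT h -> supermodular h ->
  (fun w => h (A w, D w)) \in Lfun P 1 ->
  (fun w => h (B w, D w)) \in Lfun P 1 ->
  'E_P[fun w => h (A w, D w)] <= 'E_P[fun w => h (B w, D w)].
Proof.
move=> mA mB AB resp mh hsup LA LB.
rewrite -sube_ge0 ?expectation_fin_num// -expectationB// unlock.
pose k (z : R * R * R) := (h (z.1.2, z.2) - h (z.1.1, z.2))%R.
have mk : measurable_fun setT k.
  by apply: measurable_funB; apply: measurableT_comp => //;
    apply: measurable_fun_pair => //; exact: measurableT_comp.
apply: (monotone_response_integral_ge0 (k := k) _ _ resp) => //.
- exact: measurable_fun_pair.
- move=> g g_nd; cbv zeta.
  apply: (integral_funrneg_le_funrpos_coboundary (A := A) (B := B)
    (u := potential h g)) => //.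
  + exact: measurable_potential.
  + apply: measurableT_comp => //; apply: measurable_fun_pair.
      exact: measurable_fun_pair.
    by apply: measurableT_comp => //; exact: nondecreasing_measurable.
  + by move=> w; exact: potential_le.
- apply/Lfun1_integrable.
  exact: (rpredB LB LA).
Qed.

(** The positive parts have equal integrals, and so do the negative parts. *)
Lemma expectation_same_law (A B : T -> R) (g : R -> R) :
  measurable_fun setT A -> measurable_fun setT B ->
  (forall S, measurable S -> P (A @^-1` S) = P (B @^-1` S)) ->
  measurable_fun setT g ->
  'E_P[fun w => g (A w)] = 'E_P[fun w => g (B w)].
Proof.
move=> mA mB AB mg; rewrite unlock [LHS]integralE [RHS]integralE.
have mp : measurable_fun setT (EFin \o g)^\+.
  by apply: measurable_funepos; exact/measurable_EFinP.
have mn : measurable_fun setT (EFin \o g)^\-.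
  by apply: measurable_funeneg; exact/measurable_EFinP.
have pE (C : T -> R) w : (fun w => (g (C w))%:E)^\+ w = (EFin \o g)^\+ (C w).
  by rewrite !funeposE.
have nE (C : T -> R) w : (fun w => (g (C w))%:E)^\- w = (EFin \o g)^\- (C w).
  by rewrite !funenegE.
under eq_integral do rewrite pE.
under [X in _ - X = _]eq_integral do rewrite nE.
under [X in _ = X - _]eq_integral do rewrite pE.
under [X in _ = _ - X]eq_integral do rewrite nE.
by congr (_ - _); exact: ge0_integral_same_law.
Qed.

(** Chebyshev's association inequality for a random nondecreasing function of
[A]: the covariance is the expectation of [(f A - m) * D] with [m] the mean of
[f A], and [nondecreasing_sign_change] bounds this product from below for
every frozen value of the response. *)
Lemma covariance_ge0_of_response (A D : T -> R) (f : R -> R) :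
  measurable_fun setT A -> monotone_response P A A D ->
  nondecreasing_fun f ->
  (fun w => f (A w)) \in Lfun P 1 -> D \in Lfun P 1 ->
  (fun w => f (A w) * D w)%R \in Lfun P 1 ->
  0 <= covariance P (fun w => f (A w)) D.
Proof.
move=> mA resp f_nd Lf LD LfD.
pose m := fine 'E_P[fun w => f (A w)].
have mE : 'E_P[fun w => f (A w)] = m%:E by rewrite fineK// expectation_fin_num.
pose g w := (f (A w) - m)%R.
have mf : measurable_fun setT f by exact: nondecreasing_measurable.
have Lg : g \in Lfun P 1.
  by apply: (rpredB Lf); exact: Lfun_cst.
have Eg : \int[P]_w (g w)%:E = 0.
  have := expectationB Lf (Lfun_cst P m 1).
  by rewrite expectation_cst mE subee// unlock.
have ig := (Lfun1_integrable P g).1 Lg.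
(* The mean m lies between two values of f, as needed for the sign change. *)
have [wa fa] := integral_eq0_ex_le0 ig Eg.
have LgN : (fun w => m - f (A w))%R \in Lfun P 1.
  by apply: rpredB => //; exact: Lfun_cst.
have EgN : \int[P]_w (m - f (A w))%:E = 0.
  have := expectationB (Lfun_cst P m 1) Lf.
  by rewrite expectation_cst mE subee// unlock.
have [wb fb] := integral_eq0_ex_le0 ((Lfun1_integrable P _).1 LgN) EgN.
pose k (z : R * R) := ((f z.1 - m) * z.2)%R.
have mk : measurable_fun setT k.
  apply: measurable_funM => //; apply: measurable_funB => //.
  exact: measurableT_comp.
have intE (U : T -> R) : \int[P]_w (U w)%:E = 'E_P[U] by rewrite unlock.
have LmD : (m \o* D)%R \in Lfun P 1 by exact: Lfun_scale.
have kE : (fun w => k (A w, D w)) = (fun w => f (A w) * D w - (m \o* D) w)%R.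
  by apply/funext => w; rewrite /k /=; lra.
have Lk : (fun w => k (A w, D w)) \in Lfun P 1.
  by rewrite kE; exact: (rpredB LfD LmD).
have covE : covariance P (fun w => f (A w)) D = \int[P]_w (k (A w, D w))%:E.
  rewrite covarianceE// mE intE kE.
  by apply: esym; apply: etrans (expectationB LfD LmD) _; rewrite expectationZl.
rewrite covE; apply: (monotone_response_integral_ge0 (k := k) mA mA resp) => //.
- move=> u u_nd; cbv zeta.
  have [||c cP] := @nondecreasing_sign_change R f u m (A wa) (A wb) f_nd u_nd.
  - by rewrite -subr_le0.
  - by rewrite -subr_le0.
  have LcgP : (fun w => c * g w)%R \in Lfun P 1.
    have -> : (fun w => c * g w)%R = (c \o* g)%R by apply/funext => w; rewrite /= mulrC.
    exact: Lfun_scale.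
  apply: (integral_funrneg_le_funrpos_centered (g := fun w => c * g w)%R).
  + apply: measurableT_comp => //; apply: measurable_fun_pair => //.
    by apply: measurableT_comp => //; exact: nondecreasing_measurable.
  + by apply/Lfun1_integrable; exact: LcgP.
  + rewrite intE; apply: etrans _ (mule0 c%:E); rewrite -Eg intE -expectationZl//.
    by congr expectation; apply/funext => w; rewrite /= mulrC.
  + by move=> w; exact: cP.
- exact/Lfun1_integrable.
Qed.

Lemma covarianceBr_Lfun1 (X Y Z : T -> R) :
  X \in Lfun P 1 -> Y \in Lfun P 1 -> Z \in Lfun P 1 ->
  (fun w => X w * Y w)%R \in Lfun P 1 -> (fun w => X w * Z w)%R \in Lfun P 1 ->
  covariance P X (fun w => Y w - Z w)%R = covariance P X Y - covariance P X Z.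
Proof.
move=> LX LY LZ LXY LXZ.
have XBE : (fun w => X w * (Y w - Z w))%R = (fun w => X w * Y w - X w * Z w)%R.
  by apply/funext => w; rewrite mulrBr.
have LXB : (fun w => X w * (Y w - Z w))%R \in Lfun P 1.
  by rewrite XBE; exact: (rpredB LXY LXZ).
rewrite !covarianceE//; last exact: (rpredB LY LZ).
have -> : 'E_P[(X * (fun w => Y w - Z w))%R] = 'E_P[(X * Y)%R] - 'E_P[(X * Z)%R].
  by rewrite -expectationB//; congr expectation; exact: XBE.
have -> : 'E_P[(fun w => Y w - Z w)%R] = 'E_P[Y] - 'E_P[Z].
  exact: expectationB.
have fin U : U \in Lfun P 1 -> 'E_P[U] = (fine 'E_P[U])%:E.
  by move=> LU; rewrite fineK// expectation_fin_num.
rewrite (fin X)// (fin Y)// (fin Z)// (fin (X * Y)%R)// (fin (X * Z)%R)//.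
by rewrite -!(EFinB, EFinM); congr EFin; lra.
Qed.

End comparison.

Theorem theorem3 (R : realType) (d : measure_display) (T : measurableType d)
    (P : probability T R) (X : nat -> {RV P >-> R})
    (p : nat -> R.-pker R ~> R) (pi1 : probability R R)
    (hX : markov_chain 3 X p)
    (hmono : forall n : nat, (1 <= n <= 3)%N -> stochastically_monotone (p n))
    (hshift : forall n : nat, (1 <= n <= 3)%N -> tail_shift_nonincreasing (p n))
    (hinv : invariant_distribution (p 1%N) pi1)
    (hX0 : forall A : set R, measurable A -> distribution P (X 0%N) A = pi1 A) :
  (forall h : R * R -> R,
      measurable_fun [set: R * R] h -> supermodular h ->
      (fun w => h (X 0%N w, X 2%N w - X 3%N w)) \in Lfun P 1 ->
      (fun w => h (X 1%N w, X 2%N w - X 3%N w)) \in Lfun P 1 ->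
      ('E_P[(fun w => h (X 0%N w, X 2%N w - X 3%N w))%R] <=
       'E_P[(fun w => h (X 1%N w, X 2%N w - X 3%N w))%R])%E) /\
  (forall f : R -> R,
      nondecreasing_fun f ->
      (X 2%N : T -> R) \in Lfun P 1 ->
      (X 3%N : T -> R) \in Lfun P 1 ->
      (fun w => f (X 0%N w)) \in Lfun P 1 ->
      (fun w => f (X 1%N w)) \in Lfun P 1 ->
      (fun w => f (X 0%N w) * X 2%N w) \in Lfun P 1 ->
      (fun w => f (X 0%N w) * X 3%N w) \in Lfun P 1 ->
      (fun w => f (X 1%N w) * X 2%N w) \in Lfun P 1 ->
      (fun w => f (X 1%N w) * X 3%N w) \in Lfun P 1 ->
      (0 <= covariance P (fun w => f (X 0%N w)) (X 2%N)
            - covariance P (fun w => f (X 0%N w)) (X 3%N)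
         <= covariance P (fun w => f (X 1%N w)) (X 2%N)
            - covariance P (fun w => f (X 1%N w)) (X 3%N))%E).
Proof.
have X01 := invariant_same_law hX hinv hX0.
have le_E (h : R * R -> R) : measurable_fun [set: R * R] h -> supermodular h ->
    (fun w => h (X 0%N w, X 2%N w - X 3%N w)) \in Lfun P 1 ->
    (fun w => h (X 1%N w, X 2%N w - X 3%N w)) \in Lfun P 1 ->
    ('E_P[(fun w => h (X 0%N w, X 2%N w - X 3%N w))%R] <=
     'E_P[(fun w => h (X 1%N w, X 2%N w - X 3%N w))%R])%E.
  move=> mh hs.
  apply: (supermodular_le_of_response
    (D := fun w => X 2%N w - X 3%N w)) => //.
  exact: monotone_response_past1 hX hmono hshift.
split=> // f f_nd L2 L3 Lf0 Lf1 L02 L03 L12 L13.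
have mf : measurable_fun setT f by exact: nondecreasing_measurable.
have LD : (fun w => X 2%N w - X 3%N w) \in Lfun P 1 by exact: (rpredB L2 L3).
have LfD i : (fun w => f (X i w) * X 2%N w) \in Lfun P 1 ->
    (fun w => f (X i w) * X 3%N w) \in Lfun P 1 ->
    (fun w => f (X i w) * (X 2%N w - X 3%N w)) \in Lfun P 1.
  move=> Li2 Li3; have -> : (fun w => f (X i w) * (X 2%N w - X 3%N w)) =
      (fun w => f (X i w) * X 2%N w - f (X i w) * X 3%N w).
    by apply/funext => w; rewrite mulrBr.
  exact: (rpredB Li2 Li3).
rewrite -!covarianceBr_Lfun1//; apply/andP; split.
  apply: covariance_ge0_of_response => //; last exact: LfD.
  exact: monotone_response_past0 hX hmono hshift.
rewrite !covarianceE//; [|exact: LfD..].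
rewrite (expectation_same_law (A := X 0%N) (B := X 1%N))//.
apply: leeB => //.
apply: (le_E (fun z => f z.1 * z.2)); last 2 first.
- exact: LfD.
- exact: LfD.
- by apply: measurable_funM => //; exact: measurableT_comp.
- move=> x1 x2 y1 y2 x12 y12 /=; rewrite -subr_ge0.
  have -> : f x1 * y1 + f x2 * y2 - (f x1 * y2 + f x2 * y1) =
      (f x2 - f x1) * (y2 - y1) by lra.
  by rewrite mulr_ge0// subr_ge0// f_nd.
Qed.
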